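(* The topological closure of $\sigma_{-2}(\mathbf{N}^+)$ in $\mathbf{R}$ is the union of the three pairwise disjoint closed intervals $I_1 = [1, \pi^2/9]$, $I_2 = [10/9, \pi^2/8]$, $I_3 = [5/4, \pi^2/6]$. Moreover, for $k = 1, 2, 3$, the set of positive integers $n$ such that $\sigma_{-2}(n) \in I_k$ has asymptotic density $d_k$, where $d_1 = 1/3$, $d_2 = 1/6$, and $d_3 = 1/2$.
   Context: $\mathbf{N}^+$ is the set of positive integers. For each positive integer $n$, $\sigma_{-2}(n) := \sum_{d \mid n} d^{-2}$, where $d$ runs over all positive divisors of $n$; $\sigma_{-2}(\mathbf{N}^+) := \{\sigma_{-2}(n) : n \in \mathbf{N}^+\}$ denotes the image. The asymptotic density of a set $S \subseteq \mathbf{N}^+$ is $\lim_{x \to \infty} \frac{\#\{n \in S : n \leq x\}}{x}$, when this limit exists. *)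

(* Defs.v *)
From HB Require Import structures.
From mathcomp Require Import all_boot all_order all_algebra finmap.
From mathcomp Require Import all_classical all_reals all_analysis.

Set Implicit Arguments.
Unset Strict Implicit.
Unset Printing Implicit Defensive.
Import Order.TTheory GRing.Theory Num.Theory.
Import numFieldNormedType.Exports.

Local Open Scope classical_set_scope.
Local Open Scope ring_scope.

Definition sigma_m2 {R : realType} (n : nat) : R :=
  \sum_(d <- divisors n) d%:R ^- 2.

(* [fset_set] returns the empty finite set on infinite sets, but the set
   counted here is always finite. *)
Definition count_upto {R : realType} (S : set nat) (x : R) : nat :=
  #|` fset_set [set n : nat | S n /\ n%:R <= x]|.

Definition has_density {R : realType} (S : set nat) (d : R) : Prop :=
  (count_upto S x)%:R / x @[x --> +oo] --> d.

(* Main.v *)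
Require Import Defs.
From HB Require Import structures.
From mathcomp Require Import all_boot all_order all_algebra finmap.
From mathcomp Require Import all_classical all_reals all_analysis.
From mathcomp Require Import zify ring lra.

Set Implicit Arguments.
Unset Strict Implicit.
Unset Printing Implicit Defensive.
Import Order.TTheory GRing.Theory Num.Theory.
Import numFieldNormedType.Exports.

(** Write [U N = pi^2/8 * \prod_(3 <= q < N) (1 - q^-2)] ([tailprod N]).  By the Basel
    identity and the Euler product, [U N] is the supremum of [sigma_m2] over the
    integers without prime factor below [N], so [U 3 = pi^2/8], [U 5 = pi^2/9] and
    [U N --> 1].  This bounds [sigma_m2 n] according to the divisibility of [n] by 2
    and 3, and the three cases fall into the three intervals; since [pi^2 < 10] these
    are disjoint, and the densities are those of residue classes mod 6.

    For the closure, given [x] in [1, U M), one strips off the primes [p >= M] one by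
    one, choosing the exponent [a] with
    [geom (p^-2) a <= x < geom (p^-2) a * U (p + 1)].  Such an [a] exists because
    [1 + p^-2 <= U (p + 1)] for every prime [p >= 5] (this fails for 2 and 3, whence
    the gaps).  That inequality follows from [p^-2 <= \sum_(q > p) q^-2], [q] prime,
    which for large [p] needs only the lower Chebyshev bound given by the central
    binomial coefficient and the trivial bound [n] for the number of primes below
    [2 n]; the remaining [p] are checked numerically. *)

(** * Lower bounds on the number of primes *)

(** By Legendre's formula the exponent is the sum over [k] of [2n %/ p^k - 2 (n %/ p^k)]; each term
    is at most 1 and vanishes once [p^k > 2n]. *)
Lemma expn_logn_bin_central p n :
  prime p -> (0 < n)%N -> (p ^ logn p 'C(n.*2, n) <= n.*2)%N.
Proof.
move=> pp n0.
have p1 := prime_gt1 pp.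
pose T := trunc_log p n.*2.
have n20 : (0 < n.*2)%N by rewrite double_gt0.
have bE : ('C(n.*2, n) * (n`! * n`!) = n.*2`!)%N.
  have := @bin_fact n.*2 n; rewrite -addnn addnK; apply.
  exact: leq_addr.
have lE : (logn p 'C(n.*2, n) + (logn p n`!).*2 = logn p n.*2`!)%N.
  rewrite -bE !lognM ?muln_gt0 ?fact_gt0 ?bin_gt0 ?addnn //.
  by rewrite -addnn leq_addr.
have hT : (logn p n.*2`! <= (logn p n`!).*2 + T)%N.
  rewrite !logn_fact //.
  have -> : (\sum_(1 <= k < n.+1) n %/ p ^ k = \sum_(1 <= k < n.*2.+1) n %/ p ^ k)%N.
    rewrite [RHS](@big_cat_nat _ _ _ n.+1) //=; last by rewrite ltnS -addnn leq_addr.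
    rewrite [X in (_ + X)%N]big_nat_cond [X in (_ + X)%N]big1 ?addn0 // => k /andP[/andP[k1 _] _].
    apply: divn_small; apply: (ltn_trans k1).
    exact: ltn_expl.
  apply: (@leq_trans (\sum_(1 <= k < n.*2.+1) ((n %/ p ^ k).*2 + (k <= T)))).
    apply: leq_sum => k _.
    case: (leqP k T) => kT.
      have := leq_divDl (p ^ k) n n; rewrite addnn; lia.
    rewrite divn_small // ltnNge; apply/negP => h.
    by move: kT; rewrite ltnNge trunc_log_max.
  rewrite big_split /= -(big_morph _ doubleD double0) leq_add2l.
  elim: n.*2 => [|m IH]; first by rewrite big_geq.
  rewrite big_nat_recr //=.
  have : (\sum_(1 <= i < m.+1) (i <= T) <= m)%N.
    elim: m {IH} => [|m IH]; first by rewrite big_geq.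
    by rewrite big_nat_recr //=; case: (m.+1 <= T)%N; lia.
  by case: (leqP m.+1 T); lia.
apply: (@leq_trans (p ^ T)); last exact: trunc_logP.
by rewrite leq_exp2l //; lia.
Qed.

(** Passing from [m] to [m + 1] multiplies the right-hand side by [4 (2m + 1) / (2m)], which exceeds
    4. *)
Lemma bin_central_ge n : (0 < n)%N -> (4 ^ n <= n.*2 * 'C(n.*2, n))%N.
Proof.
elim: n => // -[_ _|n IH _]; first by rewrite bin1.
have := IH isT; set m := n.+1 => {}IH.
have e1 := mul_bin_diag m.*2.+2 m.
have e2 := mul_bin_down m.*2.+1 m.
have : (m.*2.+1 - m = m.+1)%N by lia.
rewrite /= in e1 e2 => e3; rewrite e3 in e2.
rewrite doubleS expnS.
set c := 'C(m.*2, m) in IH e2; set c1 := 'C(m.*2.+1, m) in e1 e2.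
set c2 := 'C(_, _) in e1 *.
nia.
Qed.

Lemma bin_central_le_primes n : (0 < n)%N ->
  ('C(n.*2, n) <= n.*2 ^ count prime (iota 0 n.*2.+1))%N.
Proof.
move=> n0; have n20 : (0 < n.*2)%N by rewrite double_gt0.
set c := 'C(_, _).
have c0 : (0 < c)%N by rewrite bin_gt0 -addnn leq_addr.
rewrite [X in (X <= _)%N](prod_prime_decomp c0) prime_decompE big_map /=.
have pow p : p \in primes c -> (p ^ logn p c <= n.*2)%N.
  by rewrite mem_primes => /and3P[pp _ _]; exact: expn_logn_bin_central.
have sub : (size (primes c) <= count prime (iota 0 n.*2.+1))%N.
  rewrite -size_filter; apply: uniq_leq_size; first exact: primes_uniq.
  move=> p pc; have := pow _ pc; move: pc.
  rewrite mem_primes => /and3P[pp _ pdc] le.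
  rewrite mem_filter pp mem_iota /= add0n ltnS (leq_trans _ le) //.
  have : (0 < logn p c)%N by rewrite logn_gt0 mem_primes pp c0.
  by case: (logn p c) => // k _; rewrite expnS leq_pmulr // expn_gt0 prime_gt0.
apply: (@leq_trans (n.*2 ^ size (primes c))); last by rewrite leq_pexp2l.
elim: (primes c) pow {sub} => [|p s IH] pow; first by rewrite big_nil.
rewrite big_cons /= expnS leq_mul ?pow ?mem_head // IH // => q qs.
by apply: pow; rewrite inE qs orbT.
Qed.

Lemma prime_double n : (1 < n)%N -> prime n.*2 = false.
Proof.
move=> n1; apply/negP => /even_prime[e|]; last by rewrite odd_double.
by move: n1; lia.
Qed.

(** Chebyshev's argument at [n = 2^(M-1)]: [4^n] is at most [2n] times the central binomial
    coefficient, hence at most [(2n)^(c + 1)] with [c] the number of primes up to [2n = 2^M].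
    Comparing exponents of 2 gives the claim. *)
Lemma prime_count_pow2 M : (1 < M)%N ->
  (2 ^ M <= M * (count prime (iota 0 (2 ^ M))).+1)%N.
Proof.
case: M => // m m1.
have m0 : (0 < 2 ^ m)%N by rewrite expn_gt0.
have eD : ((2 ^ m).*2 = 2 ^ m.+1)%N by rewrite expnS mul2n.
have := bin_central_ge m0; have := bin_central_le_primes m0; rewrite eD.
set c := 'C(_, _).
(* The endpoint [2 ^ m.+1] is not prime, so it drops out of the count. *)
have -> : count prime (iota 0 (2 ^ m.+1).+1) = count prime (iota 0 (2 ^ m.+1)).
  rewrite -addn1 iotaD count_cat /= add0n !addn0.
  suff -> : prime (2 ^ m.+1) = false by rewrite addn0.
  by rewrite -eD prime_double // -{1}(expn0 2) ltn_exp2l.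
set pi := count _ _ => h1 h2.
rewrite -(@leq_exp2l 2) // [X in (_ <= X)%N]expnM.
have -> : (2 ^ (2 ^ m.+1) = 4 ^ (2 ^ m))%N by rewrite [(2 ^ m.+1)%N]expnS expnM.
rewrite expnS; apply: leq_trans h2 _.
by rewrite leq_mul2l h1 orbT.
Qed.

Lemma prime_count_le_half n : (1 < n)%N -> (count prime (iota 0 n.*2) <= n)%N.
Proof.
elim: n => // -[//|[//|n IH]] _.
have := IH isT; set m := n.+2.
have -> : (m.+1.*2 = m.*2 + 2)%N by lia.
rewrite iotaD count_cat /= add0n addn0.
rewrite [prime m.*2]prime_double //.
by case: (prime _); lia.
Qed.

(* Each of these primes is below [2 ^ (L + t)], so their inverse squares sum to at
   least [4 ^ t.+1 / 4 ^ (L + t) = 1 / 4 ^ (L - 1)], hence to at least [1 / p ^ 2]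
   for every [p] with [2 ^ (L - 1) <= p]. *)
Definition many_primes L t := exists s : seq nat,
  [/\ uniq s, all prime s, all (fun q => (2 ^ L <= q < 2 ^ (L + t))%N) s
    & (4 ^ t.+1 <= size s)%N].

(** The trivial bound [2 ^ L.-1] for the primes below [2 ^ L] is subtracted from the Chebyshev bound
    for those below [2 ^ (L + t)]. *)
Lemma many_primes_large L t : (1 < L)%N ->
  ((L + t) * (4 ^ t.+1 + 2 ^ L.-1) < 2 ^ (L + t))%N -> many_primes L t.
Proof.
case: L => // l l1; rewrite -pred_Sn => h.
pose s := seq.filter prime (iota (2 ^ l.+1) (2 ^ (l.+1 + t) - 2 ^ l.+1)).
have le2 : (2 ^ l.+1 <= 2 ^ (l.+1 + t))%N by rewrite leq_exp2l // leq_addr.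
exists s; split.
- by rewrite filter_uniq // iota_uniq.
- exact: filter_all.
- apply/allP => q; rewrite mem_filter mem_iota => /andP[_].
  by rewrite subnKC.
rewrite size_filter.
have e : (count prime (iota 0 (2 ^ (l.+1 + t))) = count prime (iota 0 (2 ^ l.+1)) +
   count prime (iota (2 ^ l.+1) (2 ^ (l.+1 + t) - 2 ^ l.+1)))%N.
  by rewrite -count_cat -{2}[(2 ^ l.+1)%N]add0n -iotaD subnKC.
have hl : (count prime (iota 0 (2 ^ l.+1)) <= 2 ^ l)%N.
  rewrite expnS mul2n prime_count_le_half //.
  by rewrite -{1}(expn0 2) ltn_exp2l.
have hb : (2 ^ (l.+1 + t) <= (l.+1 + t) * (count prime (iota 0 (2 ^ (l.+1 + t)))).+1)%N.
  by apply: prime_count_pow2; rewrite addSn ltnS (leq_trans _ (leq_addr _ _)) // ltnW.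
have : (4 ^ t.+1 + 2 ^ l < (count prime (iota 0 (2 ^ (l.+1 + t)))).+1)%N.
  by rewrite -(ltn_pmul2l (m := (l.+1 + t)%N)) //; apply: leq_trans h hb.
by rewrite e; lia.
Qed.

Lemma many_primes_ge14 L : (14 <= L)%N -> exists t, many_primes L t.
Proof.
move=> L14.
(* The first inequality replaces the factor [L + t] by [2 ^ t]; the last gives
   [4 ^ t.+1 <= 2 ^ (L - 2)], so the other factor is at most three quarters of [2 ^ L]. As [L] grows
   from 14, [t] is raised only when the first inequality would fail. *)
have [t [tL t5 tt]] : exists t, [/\ (L + t <= 2 ^ t)%N, (5 <= t)%N & (t.*2 + 4 <= L)%N].
  elim: L L14 => // L IH; rewrite leq_eqVlt => /orP[/eqP <-|/IH [t [h1 h2 h3]]].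
    by exists 5.
  have [h|h] := leqP (L.+1 + t) (2 ^ t); first by exists t; split=> //; lia.
  exists t.+1; rewrite expnS; split; [lia|lia|].
  suff : (3 * t + 5 <= 2 ^ t)%N by lia.
  elim: t h2 {h h1 h3} => // t IHt; rewrite leq_eqVlt => /orP[/eqP <- //|/IHt].
  by rewrite expnS; lia.
exists t; apply: many_primes_large; first by lia.
have -> : (2 ^ (L + t) = 2 ^ t * 2 ^ L)%N by rewrite addnC expnD.
apply: (@leq_ltn_trans (2 ^ t * (4 ^ t.+1 + 2 ^ L.-1))); first by rewrite leq_mul2r tL orbT.
rewrite ltn_pmul2l ?expn_gt0 //.
have -> : (4 ^ t.+1 = 2 ^ (t.*2.+2))%N.
  by rewrite -[4%N]/(2 ^ 2)%N -expnM mul2n.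
have : (2 ^ t.*2.+2 <= 2 ^ (L - 2))%N by rewrite leq_exp2l //; lia.
have -> : (2 ^ L = 4 * 2 ^ (L - 2))%N by rewrite -[4%N]/(2 ^ 2)%N -expnD; congr expn; lia.
have -> : (2 ^ L.-1 = 2 * 2 ^ (L - 2))%N by rewrite -expnS; congr expn; lia.
have : (0 < 2 ^ (L - 2))%N by rewrite expn_gt0.
lia.
Qed.

Lemma many_primes_exists L : (7 <= L)%N -> exists t, many_primes L t.
Proof.
move=> L7; have [|L14] := leqP 14 L; first exact: many_primes_ge14.
have [L11|L11] := leqP 11 L.
  (* All powers are rewritten as multiples of [2 ^ 10]; for [L = 11] the claim becomes [30 < 32]
     times that power. *)
  have pow4 k : (4 ^ k = 2 ^ k.*2)%N by rewrite -[4%N]/(2 ^ 2)%N -expnM mul2n.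
  have pow2 : (0 < 2 ^ 10)%N by rewrite expn_gt0.
  have [->|[->|->]] : L = 11 \/ L = 12 \/ L = 13 by lia.
  - exists 4; apply: many_primes_large; first by [].
    rewrite pow4 (expnD 2 5 10).
    by rewrite -[11.-1]/10 -[5.*2]/10; lia.
  - exists 4; apply: many_primes_large; first by [].
    rewrite pow4 (expnD 2 6 10).
    by rewrite -[12.-1]/(1 + 10) expnD -[5.*2]/10; lia.
  - exists 5; apply: many_primes_large; first by [].
    rewrite pow4 (expnD 2 8 10).
    by rewrite -[13.-1]/(2 + 10) -[6.*2]/(2 + 10) !expnD; lia.
(* For [t = 1] it is enough to list sixteen primes between [2 ^ L] and [2 ^ L.+1]. *)
exists 1.
have [->|[->|[->|->]]] : L = 7 \/ L = 8 \/ L = 9 \/ L = 10 by lia.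
- by exists [:: 131; 137; 139; 149; 151; 157; 163; 167; 173; 179; 181; 191; 193; 197; 199; 211]; split; vm_compute.
- by exists [:: 257; 263; 269; 271; 277; 281; 283; 293; 307; 311; 313; 317; 331; 337; 347; 349]; split; vm_compute.
- by exists [:: 521; 523; 541; 547; 557; 563; 569; 571; 577; 587; 593; 599; 601; 607; 613; 617]; split; vm_compute.
- by exists [:: 1031; 1033; 1039; 1049; 1051; 1061; 1063; 1069; 1087; 1091; 1093; 1097; 1103; 1109; 1117; 1123]; split; vm_compute.
Qed.

Local Open Scope classical_set_scope.
Local Open Scope ring_scope.

(** * The Basel identity *)

Section Basel.
Variable R : realType.
Implicit Types x y : R.

Lemma sin_lex x : 0 <= x -> sin x <= x.
Proof.
move=> x0; have [|c _] := @MVT_segment R sin cos 0 x x0.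
  by apply: continuous_subspaceT; exact: continuous_sin.
by rewrite sin0 !subr0 => ->; rewrite ler_piMl // cos_le1.
Qed.

Lemma lex_tan x : 0 <= x < pi / 2 -> x <= tan x.
Proof.
move=> /andP[x0 xpi].
have cos_gt0 z : 0 <= z -> z <= x -> 0 < cos z.
  by move=> z0 zx; apply: cos_gt0_pihalf; have := pi_gt0 R; lra.
have [||c] := @MVT_segment R tan (fun z => cos z ^- 2) 0 x x0.
- move=> c; rewrite in_itv /= => /andP[c0 cx].
  by apply: is_derive_tan; rewrite gt_eqF // cos_gt0 // ltW.
- apply/continuous_in_subspaceT => c; rewrite mem_setE in_itv /= => /andP[c0 cx].
  by apply: continuous_tan; rewrite gt_eqF // cos_gt0.
- rewrite in_itv /= => /andP[c0 cx]; rewrite tan0 !subr0 => ->.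
  have cc := cos_gt0 _ c0 cx.
  by rewrite ler_peMl // invf_ge1 ?exprn_gt0 // exprn_ile1 ?cos_le1 // ltW.
Qed.

(** Both bounds come from [sin x <= x <= tan x], the upper one because [sin^-2 = 1 + cot^2]. *)
Lemma invsin2_bounds x : 0 < x < pi / 2 ->
  x ^- 2 <= sin x ^- 2 <= x ^- 2 + 1.
Proof.
move=> /andP[x0 xpi].
have s0 : 0 < sin x by apply: sin_gt0_pihalf; rewrite x0.
have c0 : 0 < cos x by apply: cos_gt0_pihalf; have := pi_gt0 R; lra.
have sx := sin_lex (ltW x0).
apply/andP; split.
  by rewrite lef_pV2 ?posrE ?exprn_gt0 // ler_pXn2r // nnegrE ltW.
have : x <= tan x by apply: lex_tan; rewrite ltW.
rewrite /tan ler_pdivlMr // => xc.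
have h : x ^+ 2 * cos x ^+ 2 <= sin x ^+ 2.
  by rewrite -exprMn ler_pXn2r // nnegrE ?mulr_ge0 ?ltW.
rewrite cos2sin2 in h.
have -> : x ^- 2 + 1 = (1 + x ^+ 2) / x ^+ 2 by field; exact: lt0r_neq0.
rewrite -div1r ler_pdivrMr ?exprn_gt0 // mulrAC ler_pdivlMr ?exprn_gt0 //.
by lra.
Qed.

Lemma invsin2_half x : 0 < x < pi / 2 ->
  sin (x / 2) ^- 2 + sin ((pi - x) / 2) ^- 2 = 4 * sin x ^- 2.
Proof.
move=> /andP[x0 xpi].
have -> : sin ((pi - x) / 2) = cos (x / 2).
  rewrite mulrBl sinB sin_pihalf cos_pihalf; ring.
have s0 : 0 < sin (x / 2) by apply: sin_gt0_pihalf; lra.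
have c0 : 0 < cos (x / 2) by apply: cos_gt0_pihalf; lra.
have e : sin x = 2 * (cos (x / 2) * sin (x / 2)).
  by rewrite mulr_natl -sin_mulr2n; congr sin; lra.
have := cos2Dsin2 (x / 2); rewrite e.
move: (sin _) (cos _) s0 c0 => s c s0 c0 h.
have -> : s ^- 2 + c ^- 2 = (c ^+ 2 + s ^+ 2) / (s ^+ 2 * c ^+ 2).
  by field; rewrite !lt0r_neq0.
by rewrite h; field; rewrite !lt0r_neq0.
Qed.

Definition basel_node n k : R := k.*2.+1%:R * pi / (2 ^ n.+2)%:R.

Lemma basel_node_itv n k : (k < 2 ^ n)%N -> 0 < basel_node n k < pi / 2.
Proof.
move=> kn; have p0 := pi_gt0 R.
have d0 : 0 < (2 ^ n.+2)%:R :> R by rewrite ltr0n expn_gt0.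
apply/andP; split; first by rewrite /basel_node divr_gt0 // mulr_gt0 // ltr0n.
rewrite /basel_node ltr_pdivrMr // mulrC -mulrA ltr_pM2l //.
rewrite (_ : 2^-1 * _ = (2 ^ n.+1)%:R) ?ltr_nat; last first.
  by rewrite (expnS _ n.+1) natrM mulKf // pnatr_eq0.
by rewrite expnS; lia.
Qed.

(* Hofbauer's proof of the Basel identity: by [invsin2_half], halving the step
   replaces each node [y] by the nodes [y / 2] and [(pi - y) / 2], which are
   again the odd multiples of the halved step in [0, pi / 2]. *)
Lemma sum_invsin2_node n :
  \sum_(0 <= k < 2 ^ n) sin (basel_node n k) ^- 2 = 2 * 4 ^+ n :> R.
Proof.
elim: n => [|n IH].
  rewrite expn0 big_nat1 expr0 mulr1 /basel_node /= mul1r.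
  have := cos2Dsin2 (pi / 4 : R).
  have -> : cos (pi / 4) = sin (pi / 4) :> R.
    by rewrite -[RHS]cosBpihalf -[LHS]cosN; congr (cos _); lra.
  move=> h; have -> : sin (pi / 4) ^+ 2 = 2^-1 :> R by lra.
  by rewrite invrK.
have e2 : (2 ^ n.+1 = 2 ^ n + 2 ^ n)%N by rewrite expnS mul2n addnn.
rewrite {1}e2 (@big_cat_nat _ _ _ (2 ^ n)) //= ?leq_addr //.
rewrite [X in _ + X](big_addn 0) addnK.
(* Reversing the upper half of the sum aligns each [(pi - y) / 2] with the corresponding [y / 2]. *)
rewrite [X in _ + X]big_nat_rev /= -big_split /= exprS mulrCA -IH big_distrr /=.
rewrite !big_nat; apply: eq_bigr => k /andP[_ kn].
rewrite -invsin2_half ?basel_node_itv //.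
have d0 : (2 ^ n.+2)%:R != 0 :> R by rewrite pnatr_eq0 -lt0n expn_gt0.
have step : (2 ^ n.+3)%:R = 2 * (2 ^ n.+2)%:R :> R by rewrite expnS natrM.
congr (sin _ ^- 2 + sin _ ^- 2); rewrite /basel_node step.
  by field.
have -> : ((0 + 2 ^ n - k.+1 + 2 ^ n).*2.+1 = 2 ^ n.+2 - k.*2.+1)%N.
  by rewrite !expnS; lia.
rewrite natrB; last by rewrite !expnS; lia.
by field.
Qed.

Definition odd_invsq_sum m : R := \sum_(0 <= k < m) k.*2.+1%:R ^- 2.

(** Summing [invsin2_bounds] over the [2 ^ n] nodes squeezes [2 * 4^n] between [16 * 4^n / pi^2]
    times the odd sum and the same quantity plus [2^n]. After rescaling, the error is
    [pi^2 / 16 * 2^-n], and [pi < 4]. *)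
Lemma odd_invsq_sum_pow2 n :
  odd_invsq_sum (2 ^ n) <= pi ^+ 2 / 8 <= odd_invsq_sum (2 ^ n) + 2 ^- n.
Proof.
have p0 := pi_gt0 R; have p4 : pi < 4 :> R by have := pihalf_lt2 R; lra.
have e : \sum_(0 <= k < 2 ^ n) basel_node n k ^- 2
    = 16 * 4 ^+ n / pi ^+ 2 * odd_invsq_sum (2 ^ n) :> R.
  rewrite /odd_invsq_sum big_distrr /=; apply: eq_bigr => k _.
  rewrite /basel_node !expnS !natrM natrX.
  have -> : 4 ^+ n = (2 ^+ n) ^+ 2 :> R by rewrite -exprM mulnC exprM; congr (_ ^+ n); lra.
  have h (a p t : R) : a != 0 -> p != 0 -> t != 0 ->
      (a * p / (2 * (2 * t))) ^- 2 = 16 * t ^+ 2 / p ^+ 2 * a ^- 2.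
    by move=> a0 q0 t0; field; rewrite a0 q0 t0.
  by apply: h; rewrite ?expf_neq0 ?pnatr_eq0 // gt_eqF.
have s := sum_invsin2_node n.
have q0 : 0 < 4 ^+ n :> R by rewrite exprn_gt0.
have lo : 16 * 4 ^+ n / pi ^+ 2 * odd_invsq_sum (2 ^ n) <= 2 * 4 ^+ n.
  rewrite -e -s !big_nat; apply: ler_sum => k /andP[_ kn].
  by have /invsin2_bounds/andP[] := basel_node_itv kn.
have hi : 2 * 4 ^+ n <= 16 * 4 ^+ n / pi ^+ 2 * odd_invsq_sum (2 ^ n) + 2 ^+ n.
  have -> : 2 ^+ n = \sum_(0 <= k < 2 ^ n) 1 :> R.
    by rewrite sumr_const_nat subn0 natrX.
  rewrite -e -s -big_split /= !big_nat; apply: ler_sum => k /andP[_ kn].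
  by have /invsin2_bounds/andP[] := basel_node_itv kn.
have E4 : 4 ^+ n = 2 ^+ n * 2 ^+ n :> R by rewrite -exprMn; congr (_ ^+ n); lra.
have t0 : 0 < 2 ^+ n :> R by rewrite exprn_gt0.
set S := odd_invsq_sum _ in lo hi *.
apply/andP; split.
  have : S * (16 * 4 ^+ n) <= pi ^+ 2 / 8 * (16 * 4 ^+ n).
    have -> : S * (16 * 4 ^+ n) = (16 * 4 ^+ n / pi ^+ 2 * S) * pi ^+ 2.
      by move: p0; move: (pi : R) => p p0; field; rewrite gt_eqF.
    by have := ler_wpM2r (sqr_ge0 (pi : R)) lo; lra.
  by rewrite ler_pM2r // mulr_gt0.
rewrite -(ler_pM2r (mulr_gt0 _ q0 : 0 < 16 * 4 ^+ n)) //.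
have -> : (S + 2 ^- n) * (16 * 4 ^+ n)
  = (16 * 4 ^+ n / pi ^+ 2 * S) * pi ^+ 2 + 16 * 2 ^+ n.
  rewrite E4; move: (pi : R) p0 (2 ^+ n) t0 => p p0 t t0.
  by field; rewrite !gt_eqF.
have h1 := ler_wpM2r (sqr_ge0 pi : 0 <= pi ^+ 2 :> R) hi.
have h2 : 2 ^+ n * pi ^+ 2 <= 2 ^+ n * 16 :> R.
  by rewrite ler_pM2l //; nra.
by lra.
Qed.
End Basel.

(** * Bounds on [sigma_m2] *)

Section SigmaM2.
Variable R : realType.
Implicit Types (r x y z e : R) (n m p a : nat).

Local Notation sigma := (@sigma_m2 R).

Lemma ler_sum_sub (I : eqType) (s t : seq I) (F : I -> R) :
  uniq s -> uniq t -> {subset s <= t} -> (forall i, 0 <= F i) ->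
  \sum_(i <- s) F i <= \sum_(i <- t) F i.
Proof.
move=> us ut st F0.
have pt : perm_eq t (s ++ [seq i <- t | i \notin s]).
  rewrite uniq_perm //.
    rewrite cat_uniq us filter_uniq // andbT; apply/hasPn => i.
    by rewrite mem_filter => /andP[].
  move=> i; rewrite mem_cat mem_filter; case: (boolP (i \in s)) => //= /st //.
by rewrite (perm_big _ pt) big_cat /= lerDl sumr_ge0.
Qed.

Lemma invsq_ge0 n : 0 <= n%:R ^- 2 :> R.
Proof. by rewrite invr_ge0 exprn_ge0. Qed.

Lemma invsq_itv n : (1 < n)%N -> 0 < (n%:R ^- 2 : R) < 1.
Proof.
move=> n1; rewrite invr_gt0 exprn_gt0 ?ltr0n ?(ltn_trans _ n1) //=.
by rewrite invf_lt1 ?exprn_gt0 ?ltr0n ?(ltn_trans _ n1) // exprn_egt1 // ltr1n.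
Qed.

(** This is [1 + r + ... + r^a] in closed form; for [r = p^-2] it is the value of [sigma] at
    [p^a]. *)
Definition geom r a := (1 - r ^+ a.+1) / (1 - r).

Lemma geom0 r : r < 1 -> geom r 0 = 1.
Proof. by move=> r1; rewrite /geom expr1 divff // subr_eq0 gt_eqF. Qed.

Lemma geomS r a : r < 1 -> geom r a.+1 = 1 + r * geom r a.
Proof.
move=> r1; rewrite /geom exprS.
by field; rewrite subr_eq0 gt_eqF.
Qed.

Lemma geomSr r a : r < 1 -> geom r a.+1 = geom r a + r ^+ a.+1.
Proof.
move=> r1; rewrite /geom exprS.
by field; rewrite subr_eq0 gt_eqF.
Qed.

Lemma geom_ge1 r a : 0 < r < 1 -> 1 <= geom r a.
Proof.
move=> /andP[r0 r1]; elim: a => [|a IH]; first by rewrite geom0.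
by rewrite geomSr // ler_wpDr // exprn_ge0 // ltW.
Qed.

Lemma geom_mul_le1 r a : 0 < r < 1 -> geom r a * (1 - r) <= 1.
Proof.
move=> /andP[r0 r1]; rewrite /geom divfK; last by rewrite subr_eq0 gt_eqF.
by rewrite gerBl exprn_ge0 // ltW.
Qed.

(** This bounds the ratio of consecutive scales uniformly for [a >= a0], which is how the overlap
    condition of [geom_cover] gets checked. *)
Lemma geom_step r a0 a : 0 < r < 1 -> (a0 <= a)%N ->
  geom r a.+1 <= geom r a * (1 + r ^+ a0.+1).
Proof.
move=> r01 le; have /andP[r0 r1] := r01.
rewrite geomSr // mulrDr mulr1 lerD2l.
apply: (@le_trans _ _ (r ^+ a0.+1)); first by rewrite ler_wiXn2l ?ltnS // ltW.
by rewrite ler_peMl ?geom_ge1 // exprn_ge0 // ltW.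
Qed.

Lemma small_expr r e : 0 < r < 1 -> 0 < e -> exists a, r ^+ a < e.
Proof.
move=> /andP[r0 r1] e0.
have : (fun n => r ^+ n) @ \oo --> (0 : R).
  by apply: cvg_expr; rewrite ger0_norm // ltW.
move=> /cvgrPdist_lt /(_ e e0)[a _ /(_ a (leqnn a))] /=.
by rewrite sub0r normrN ger0_norm ?exprn_ge0 ?ltW // => h; exists a.
Qed.

Lemma geom_limit_le r y z : 0 < r < 1 -> 0 <= y ->
  (forall a, geom r a * y <= z) -> y / (1 - r) <= z.
Proof.
move=> r01 y0 h; have /andP[r0 r1] := r01.
have d0 : 0 < 1 - r by rewrite subr_gt0.
rewrite leNgt; apply/negP => zy.
(* With [w = y / (1 - r)] the product [geom r a * y] is [w - r^(a+1) w], so [r^a w < w - z]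
   contradicts the hypothesis; the [+ 1] keeps the denominator positive. *)
have [a ra] : exists a, r ^+ a < (y / (1 - r) - z) / (y / (1 - r) + 1).
  apply: small_expr => //; rewrite divr_gt0 ?subr_gt0 //.
  by rewrite ltr_wpDl // divr_ge0 // ltW.
have := h a; apply/negP; rewrite -ltNge /geom.
set w := y / (1 - r) in ra zy.
have w0 : 0 <= w by rewrite divr_ge0 // ltW.
have -> : (1 - r ^+ a.+1) / (1 - r) * y = w - r ^+ a.+1 * w by rewrite /w; ring.
rewrite ltr_pdivlMr in ra; last by rewrite ltr_wpDl.
have ra0 : 0 < r ^+ a by rewrite exprn_gt0.
have : r ^+ a.+1 <= r ^+ a by rewrite ler_wiXn2l // ltW.
nra.
Qed.

(** The scaled intervals [geom r a * [lo, hi)] with [a >= a0] overlap successively, and their right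
    ends tend to [hi / (1 - r)]. The least [a >= a0] whose right end exceeds [x] works. *)
Lemma geom_cover r lo hi a0 x : 0 < r < 1 -> 0 <= hi ->
  geom r a0 * lo <= x < hi / (1 - r) ->
  (forall a, (a0 <= a)%N -> geom r a.+1 * lo <= geom r a * hi) ->
  exists a, geom r a * lo <= x < geom r a * hi.
Proof.
move=> r01 hi0 /andP[lox xhi] step.
have /existsNP[a1 /negP] : ~ forall a, geom r a * hi <= x.
  by move=> /(geom_limit_le r01 hi0); rewrite leNgt xhi.
rewrite -ltNge => a1P.
have ex : exists a, (a0 <= a)%N && (x < geom r a * hi).
  have [le|lt] := leqP a0 a1; first by exists a1; rewrite le.
  exists a0; rewrite leqnn (lt_le_trans a1P) // ler_wpM2r //.
  rewrite ler_pM2r ?invr_gt0 ?subr_gt0; last by case/andP: r01.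
  by rewrite lerB // ler_wiXn2l ?ltnS; [|case/andP: r01 => /ltW|case/andP: r01 => _ /ltW|exact: ltnW].
case: (ex_minnP ex) => a /andP[a0a xa] amin; exists a; rewrite xa andbT.
have [->//|ne] := eqVneq a a0.
case: a a0a xa amin ne => [|a] a0a xa amin ne; first by rewrite leqn0 eq_sym in a0a; rewrite a0a in ne.
have a0a' : (a0 <= a)%N by rewrite -ltnS ltn_neqAle eq_sym ne.
apply: le_trans (step _ a0a') _; rewrite leNgt; apply/negP => xlt.
by have := amin a; rewrite a0a' xlt ltnn => /(_ isT).
Qed.

Lemma sigma_ge1 n : (0 < n)%N -> 1 <= sigma n.
Proof.
move=> n0; have := @ler_sum_sub _ [:: 1%N] _ _ isT (divisors_uniq n) _ invsq_ge0.
rewrite big_seq1 expr1n invr1; apply.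
by move=> d; rewrite inE => /eqP ->; rewrite -dvdn_divisors.
Qed.

Lemma sigma1 : sigma 1 = 1.
Proof. by rewrite /sigma_m2 -[divisors 1]/[:: 1%N] big_seq1 expr1n invr1. Qed.

(** The divisors of [p * m] prime to [p] are those of [n]; the others are [p] times the divisors of
    [m]. This is the recursion [geomS]. *)
Lemma sigma_prime_mul p n m : prime p -> (0 < n)%N -> ~~ (p %| n)%N ->
  (exists a, m = p ^ a * n)%N ->
  sigma (p * m) = sigma n + p%:R ^- 2 * sigma m.
Proof.
move=> pp n0 pn [a mE]; have p0 := prime_gt0 pp.
have m0 : (0 < m)%N by rewrite mE muln_gt0 expn_gt0 p0.
have pe : perm_eq (divisors (p * m)) (divisors n ++ [seq (p * d)%N | d <- divisors m]).
  rewrite uniq_perm ?divisors_uniq //.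
    rewrite cat_uniq divisors_uniq map_inj_uniq ?divisors_uniq ?andbT /=; last first.
      by move=> d d' /eqP; rewrite eqn_pmul2l // => /eqP.
    apply/hasPn => _ /mapP[d dm ->]; rewrite -dvdn_divisors //.
    by apply: contra pn => /(dvdn_trans (dvdn_mulr _ (dvdnn p))).
  move=> d; rewrite mem_cat -!dvdn_divisors ?muln_gt0 ?p0 //.
  apply/idP/idP; last first.
    case/orP => [dn|/mapP[d' + ->]].
      by rewrite mE mulnA dvdn_mull.
    by rewrite -dvdn_divisors // => h; rewrite dvdn_pmul2l.
  move=> dpm; have [/dvdnP[d' dE]|pd] := boolP (p %| d)%N.
    apply/orP; right; apply/mapP; exists d'; last by rewrite dE mulnC.
    by rewrite -dvdn_divisors //; rewrite dE mulnC dvdn_pmul2l in dpm.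
  apply/orP; left; move: dpm; rewrite mE mulnA -expnS Gauss_dvdr //.
  by rewrite coprimeXr // coprime_sym prime_coprime.
rewrite /sigma_m2 (perm_big _ pe) big_cat big_map /= big_distrr /=.
congr (_ + _); apply: eq_bigr => d _.
by rewrite natrM exprMn invfM.
Qed.

Lemma sigma_prime_pow p a n : prime p -> (0 < n)%N -> ~~ (p %| n)%N ->
  sigma (p ^ a * n) = geom (p%:R ^- 2) a * sigma n.
Proof.
move=> pp n0 pn; have /andP[_ r1] := invsq_itv (prime_gt1 pp).
elim: a => [|a IH]; first by rewrite expn0 mul1n geom0 ?mul1r.
rewrite expnS -mulnA (@sigma_prime_mul p n); [|by []..|by exists a].
rewrite IH geomS //; ring.
Qed.

Lemma prime_pow_split p n : prime p -> (0 < n)%N ->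
  exists a m, [/\ n = (p ^ a * m)%N, (0 < m)%N & ~~ (p %| m)%N].
Proof.
move=> pp n0; have [m mp e] := pfactor_coprime pp n0.
exists (logn p n), m; split; first by rewrite mulnC.
  by move: n0; rewrite e muln_gt0 => /andP[].
by rewrite -prime_coprime.
Qed.

(** * Rough integers and the Euler product *)

Definition rough N n := (0 < n)%N /\ forall p, prime p -> (p %| n)%N -> (N <= p)%N.

Lemma rough_leq M N n : (M <= N)%N -> rough N n -> rough M n.
Proof. by move=> le [n0 h]; split=> // p pp /(h _ pp); exact: leq_trans. Qed.

Lemma rough_prime_pow p a n : prime p -> rough p.+1 n ->
  rough p (p ^ a * n) /\ ~~ (p %| n)%N.
Proof.
move=> pp [n0 h]; split; last first.
  by apply/negP => /(h _ pp); rewrite ltnn.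
split; first by rewrite muln_gt0 expn_gt0 prime_gt0.
move=> q qq; rewrite Euclid_dvdM // => /orP[|/(h _ qq)/ltnW //].
by rewrite Euclid_dvdX // dvdn_prime2 // => /andP[/eqP ->].
Qed.

(** The product starts at 3 because [pi^2 / 8], a sum over odd integers, already lacks the factor at
    2. *)
Definition euler N : R := \prod_(3 <= q < N | prime q) (1 - q%:R ^- 2).

Definition tailprod N : R := pi ^+ 2 / 8 * euler N.

Lemma euler3 : euler 3 = 1.
Proof. by rewrite /euler big_geq. Qed.

Lemma eulerS N : (3 <= N)%N ->
  euler N.+1 = if prime N then euler N * (1 - N%:R ^- 2) else euler N.
Proof. by move=> N3; rewrite /euler big_mkcond big_nat_recr //= -big_mkcond; case: ifP; rewrite ?mulr1. Qed.

Lemma tailprodS N : (3 <= N)%N ->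
  tailprod N.+1 = if prime N then tailprod N * (1 - N%:R ^- 2) else tailprod N.
Proof. by move=> N3; rewrite /tailprod eulerS //; case: ifP; rewrite ?mulrA. Qed.

Lemma euler_gt0 N : 0 < euler N.
Proof.
rewrite /euler; apply: prodr_gt0 => q /prime_gt1/invsq_itv/andP[_ h].
by rewrite subr_gt0.
Qed.

(** The divisors are distinct odd numbers, and since [n < 2 ^ n] they all occur in the partial sum
    with [2 ^ n] terms. *)
Lemma sigma_odd_le n : odd n -> sigma n <= pi ^+ 2 / 8.
Proof.
move=> on; have /andP[h _] := odd_invsq_sum_pow2 R n.
apply: le_trans h; rewrite /odd_invsq_sum /sigma_m2.
have n0 : (0 < n)%N by case: n on.
rewrite -(@big_map _ _ _ _ _ (fun k => k.*2.+1) _ xpredT (fun d => d%:R ^- 2 : R)).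
apply: ler_sum_sub; last exact: invsq_ge0.
- exact: divisors_uniq.
- rewrite map_inj_uniq ?iota_uniq // => i j [].
  exact: double_inj.
move=> d; rewrite -dvdn_divisors // => dn.
have od : odd d by apply: dvdn_odd dn on.
apply/mapP; exists d./2; last by rewrite -[LHS](odd_double_half d) od.
rewrite mem_index_iota /=.
have := dvdn_leq n0 dn; have := ltn_expl n (isT : (1 < 2)%N).
by have := leq_half_double d d; lia.
Qed.

(** Induction on [N]: if [n] is [p.+1]-rough, then every [p ^ a * n] is [p]-rough, so
    [geom (p^-2) a * sigma n] stays below [tailprod p]; letting [a] grow gives the factor
    [1 - p^-2]. No infinite product is involved. *)
Lemma sigma_le_tailprod N n : (3 <= N)%N -> rough N n -> sigma n <= tailprod N.
Proof.
move=> N3; rewrite -(subnKC N3); elim: (N - 3)%N n => [|k IH] n.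
  rewrite addn0 => -[n0 h]; rewrite /tailprod euler3 mulr1; apply: sigma_odd_le.
  by have := h 2%N isT; rewrite dvdn2; case: (odd n) => // /(_ isT).
rewrite addnS; set p := (3 + k)%N in IH * => rn.
rewrite tailprodS //; case: ifP => pp; last first.
  by apply: IH; apply: rough_leq rn.
have r01 := invsq_itv (prime_gt1 pp); have /andP[r0 r1] := r01.
have s1 := sigma_ge1 rn.1.
rewrite -ler_pdivrMr ?subr_gt0 //; apply: geom_limit_le => //.
  by apply: le_trans s1.
move=> a; have [rpn pn] := rough_prime_pow a pp rn.
by rewrite -sigma_prime_pow ?IH //; case: rn.
Qed.

Lemma rough1 N : rough N 1.
Proof. by split=> // p pp; rewrite dvdn1 => /eqP e; rewrite e in pp. Qed.

Lemma tailprod_ge1 N : (3 <= N)%N -> 1 <= tailprod N.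
Proof. by move=> N3; rewrite -sigma1; apply: sigma_le_tailprod => //; exact: rough1. Qed.

(** Each prime contributes a factor [geom (p^-2) a * (1 - p^-2) <= 1]. This converse estimate is
    what forces [tailprod] down to 1. *)
Lemma sigma_euler_le1 N n : (3 <= N)%N -> rough 3 n ->
  (forall p, prime p -> (p %| n)%N -> (p < N)%N) -> sigma n * euler N <= 1.
Proof.
move=> N3; rewrite -(subnKC N3); elim: (N - 3)%N n => [|k IH] n.
  rewrite addn0 => -[n0 h1] h2; rewrite euler3 mulr1.
  have [n1|n1] := leqP n 1; first by rewrite (_ : n = 1%N) ?sigma1 //; lia.
  have pp := pdiv_prime n1; have pd := pdiv_dvd n.
  by have := h1 _ pp pd; have := h2 _ pp pd; lia.
rewrite addnS; set p := (3 + k)%N in IH * => rn small.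
rewrite eulerS //; case: ifP => pp; last first.
  apply: IH => // q qq qn; have := small _ qq qn; rewrite ltnS leq_eqVlt => /orP[/eqP e|//].
  by rewrite e pp in qq.
have r01 := invsq_itv (prime_gt1 pp); have /andP[r0 r1] := r01.
have [a [m [nE m0 pm]]] := prime_pow_split pp rn.1.
have mn : (m %| n)%N by rewrite nE dvdn_mull.
rewrite nE sigma_prime_pow // [euler p * _]mulrC mulrACA.
have h1 := geom_mul_le1 a r01.
have h2 : sigma m * euler p <= 1.
  apply: IH; first by split=> // q qq qm; apply: (rn.2 _ qq); apply: dvdn_trans mn.
  move=> q qq qm; have := small _ qq (dvdn_trans qm mn).
  rewrite ltnS leq_eqVlt => /orP[/eqP e|//].
  by rewrite e (negbTE pm) in qm.
rewrite -[leRHS]mulr1; apply: ler_pM => //.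
  apply: mulr_ge0; last by rewrite subr_ge0 ltW.
  by apply: le_trans ler01 _; exact: geom_ge1.
apply: mulr_ge0; last exact/ltW/euler_gt0.
by apply: le_trans ler01 _; exact: sigma_ge1.
Qed.
End SigmaM2.

(** * Approximation by values of [sigma_m2] *)

Section Range.
Variable R : realType.
Implicit Types (r x y z e : R) (n m p a : nat).

Local Notation sigma := (@sigma_m2 R).
Local Notation tail := (@tailprod R).

Lemma tailprod_near1 e : 0 < e -> exists2 N, (3 <= N)%N & forall M, (N <= M)%N -> tail M <= 1 + e.
Proof.
move=> e0.
have [n n_e] : exists n, (2^-1 : R) ^+ n < e by apply: small_expr => //; lra.
have mono M N : (3 <= N)%N -> (N <= M)%N -> tail M <= tail N.
  move=> N3 /subnKC <-; elim: (M - N)%N => [|k IH]; first by rewrite addn0.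
  rewrite addnS tailprodS ?(leq_trans N3) ?leq_addr //; case: ifP => // pp.
  have /andP[r0 r1] := invsq_itv R (prime_gt1 pp).
  apply: le_trans IH; rewrite ler_piMr ?gerBl ?ltW //.
  by apply: lt_le_trans ltr01 _; apply: tailprod_ge1; rewrite (leq_trans N3) ?leq_addr.
pose m := (2 ^ n.+1)%N.
have m2 : (2 <= m)%N by rewrite /m -{1}(expn1 2) leq_exp2l.
exists m.*2; first by lia.
move=> M mM; apply: le_trans (mono _ m.*2 _ mM) _; first by lia.
(* Every odd number below [2m] divides [K], so [sigma K] dominates the odd sum, which is within
   [2^-(n+1)] of [pi^2 / 8]; all primes of [K] are odd and below [2m], so
   [sigma K * euler (2m) <= 1]. *)
pose K := (\prod_(0 <= k < m) k.*2.+1)%N.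
have K0 : (0 < K)%N by rewrite /K prodn_gt0.
have dK p : prime p -> (p %| K)%N -> odd p && (p < m.*2)%N.
  move=> pp; rewrite /K; elim: (m) => [|k IH].
    by rewrite big_geq // dvdn1 => /eqP e1; rewrite e1 in pp.
  rewrite big_nat_recr //= Euclid_dvdM // => /orP[/IH/andP[-> h]|h]; first by rewrite doubleS ltnW // ltnW.
  rewrite (dvdn_odd h) /= ?odd_double //.
  by have := dvdn_leq _ h; rewrite doubleS; lia.
have Kd k : (k < m)%N -> (k.*2.+1 %| K)%N.
  move=> km; rewrite /K (big_rem k) /= ?dvdn_mulr // mem_index_iota //.
have lo : odd_invsq_sum R m <= sigma K.
  rewrite /odd_invsq_sum /sigma_m2.
  rewrite -(@big_map _ _ _ _ _ (fun k => k.*2.+1) _ xpredT (fun d => d%:R ^- 2 : R)).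
  apply: ler_sum_sub; [|exact: divisors_uniq| |exact: invsq_ge0].
    by rewrite map_inj_uniq ?iota_uniq // => i j []; exact: double_inj.
  move=> _ /mapP[k km ->]; rewrite -dvdn_divisors // Kd //.
  by move: km; rewrite mem_index_iota.
have hi : sigma K * euler R m.*2 <= 1.
  apply: sigma_euler_le1 => //; first by lia.
    split=> // p pp /(dK _ pp)/andP[op _]; exact: odd_prime_gt2.
  by move=> p pp /(dK _ pp)/andP[].
have /andP[_ basel] := odd_invsq_sum_pow2 R n.+1; rewrite -/m in basel.
have O1 : 1 <= odd_invsq_sum R m.
  rewrite /odd_invsq_sum /m big_ltn ?expn_gt0 // expr1n invr1 lerDl sumr_ge0 //.
have eg := euler_gt0 R m.*2.
have en : 2 ^- n.+1 <= e.
  apply: ltW; apply: le_lt_trans n_e; rewrite exprVn lef_pV2 ?posrE ?exprn_gt0 //.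
  by rewrite ler_eXn2l // ltr1n.
rewrite /tailprod; move: (euler _ _) (odd_invsq_sum _ _) (sigma K) eg lo hi basel O1 => E O s E0 h1 h2 h3 h4.
have OE : O * E <= 1 by apply: le_trans h2; rewrite ler_pM2r.
have E1 : E <= 1 by apply: le_trans OE; rewrite ler_peMl // ltW.
have := ler_wpM2r (ltW E0) h3; rewrite mulrDl.
have : 2 ^- n.+1 * E <= 2 ^- n.+1 by rewrite ler_piMr // invr_ge0 exprn_ge0.
by lra.
Qed.

(** A new prime with [r = q^-2] preserves the bound, as [(1 - r) (1 + S + r) <= 1 + S]. *)
Lemma tailprod_sum_le M N : (3 <= M <= N)%N ->
  tail N * (1 + \sum_(M <= q < N | prime q) q%:R ^- 2) <= tail M.
Proof.
move=> /andP[M3 /subnKC <-]; elim: (N - M)%N => [|k IH].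
  by rewrite addn0 big_geq // addr0 mulr1.
rewrite addnS tailprodS ?(leq_trans M3) ?leq_addr //.
rewrite big_mkcond big_nat_recr ?leq_addr //= -big_mkcond /=.
case: ifP => pp; last by rewrite addr0.
apply: le_trans IH; rewrite -mulrA ler_pM2l; last first.
  by apply: lt_le_trans ltr01 _; apply: tailprod_ge1; rewrite (leq_trans M3) ?leq_addr.
have /andP[r0 r1] := invsq_itv R (prime_gt1 pp).
set S := \sum_(_ <= _ < _ | _) _.
have S0 : 0 <= S by apply: sumr_ge0 => i _; exact: invsq_ge0.
move: (_ ^- 2) r0 r1 => r r0 r1; nra.
Qed.

Lemma ler_invsq x y : 0 < x -> x <= y -> y ^- 2 <= x ^- 2.
Proof.
move=> x0 xy; have y0 := lt_le_trans x0 xy.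
by rewrite lef_pV2 ?posrE ?exprn_gt0 // ler_pXn2r // nnegrE ltW.
Qed.

(** With [2^l <= p < 2^(l+1)], the primes given by [many_primes] at [L = l + 1] all exceed [p];
    [p >= 64] ensures [L >= 7]. *)
Lemma prime_tail_sum_large p : prime p -> (64 <= p)%N -> exists2 s : seq nat,
  [/\ uniq s, all prime s & all (ltn p) s] & p%:R ^- 2 <= \sum_(q <- s) q%:R ^- 2 :> R.
Proof.
move=> pp p64; have p0 := prime_gt0 pp.
pose l := trunc_log 2 p.
have l6 : (6 <= l)%N by rewrite /l -(@trunc_expnK 2 6) // leq_trunc_log.
have lp : (2 ^ l <= p)%N by apply: trunc_logP.
have pl : (p < 2 ^ l.+1)%N by apply: trunc_log_ltn.
have [t [s [us ps ss sz]]] := many_primes_exists (L := l.+1) l6.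
exists s; first split=> //.
  by apply/allP => q /(allP ss) /andP[h _]; apply: leq_trans pl h.
have pow2gt0 k : 0 < 2 ^+ k :> R by rewrite exprn_gt0.
apply: (@le_trans _ _ ((size s)%:R * (2 ^+ (l.+1 + t)) ^- 2)).
  apply: (@le_trans _ _ ((4 ^+ t.+1) * (2 ^+ (l.+1 + t)) ^- 2)).
    have -> : 4 ^+ t.+1 * (2 ^+ (l.+1 + t)) ^- 2 = (2 ^+ l) ^- 2 :> R.
      have -> : 4 ^+ t.+1 = (2 ^+ t.+1) ^+ 2 :> R.
        by rewrite -exprM mulnC exprM; congr (_ ^+ _); lra.
      rewrite addSnnS exprD; move: (2 ^+ l) (2 ^+ t.+1) (pow2gt0 l) (pow2gt0 t.+1) => u v u0 v0.
      by field; rewrite !gt_eqF.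
    by apply: ler_invsq; rewrite // -natrX ler_nat.
  by rewrite ler_pM2r ?invr_gt0 ?exprn_gt0 // -natrX ler_nat.
rewrite -sum1_size natr_sum big_distrl /=.
rewrite !big_seq; apply: ler_sum => q qs; rewrite mul1r.
have /andP[_ h] := allP ss q qs.
have q0 : (0 < q)%N by apply/prime_gt0/(allP ps).
by apply: ler_invsq; rewrite ?ltr0n // -natrX ler_nat ltnW.
Qed.

Lemma prime_tail_sum p : prime p -> (5 <= p)%N -> exists2 s : seq nat,
  [/\ uniq s, all prime s & all (ltn p) s] & p%:R ^- 2 <= \sum_(q <- s) q%:R ^- 2 :> R.
Proof.
move=> pp p5; have [|p64] := leqP 64 p; first exact: prime_tail_sum_large.
have : p \in [:: 5; 7; 11; 13; 17; 19; 23; 29; 31; 37; 41; 43; 47; 53; 59; 61]%N.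
  have -> : [:: 5; 7; 11; 13; 17; 19; 23; 29; 31; 37; 41; 43; 47; 53; 59; 61]%N
    = [seq q <- iota 5 59 | prime q] by vm_compute.
  by rewrite mem_filter pp mem_iota; lia.
have go a s : [&& uniq s, all prime s & all (ltn a) s] -> p = a ->
    a%:R ^- 2 <= \sum_(q <- s) q%:R ^- 2 :> R ->
    exists2 s : seq nat, [/\ uniq s, all prime s & all (ltn p) s] &
      p%:R ^- 2 <= \sum_(q <- s) q%:R ^- 2 :> R.
  by move=> /and3P[us ps ss] -> h; exists s.
rewrite !inE; do ![case/orP]; move=> /eqP pE.
(* A few primes following [p] suffice; for [p = 7] the four listed ones exceed [1/49] by less than
   [10^-5]. *)
- by apply: (go _ [:: 7; 11; 13; 17; 19]%N _ pE) => //; rewrite !big_cons big_nil; lra.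
- by apply: (go _ [:: 11; 13; 17; 19]%N _ pE) => //; rewrite !big_cons big_nil; lra.
- by apply: (go _ [:: 13; 17]%N _ pE) => //; rewrite !big_cons big_nil; lra.
- by apply: (go _ [:: 17; 19]%N _ pE) => //; rewrite !big_cons big_nil; lra.
- by apply: (go _ [:: 19; 23]%N _ pE) => //; rewrite !big_cons big_nil; lra.
- by apply: (go _ [:: 23; 29]%N _ pE) => //; rewrite !big_cons big_nil; lra.
- by apply: (go _ [:: 29; 31]%N _ pE) => //; rewrite !big_cons big_nil; lra.
- by apply: (go _ [:: 31; 37]%N _ pE) => //; rewrite !big_cons big_nil; lra.
- by apply: (go _ [:: 37; 41]%N _ pE) => //; rewrite !big_cons big_nil; lra.
- by apply: (go _ [:: 41; 43]%N _ pE) => //; rewrite !big_cons big_nil; lra.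
- by apply: (go _ [:: 43; 47]%N _ pE) => //; rewrite !big_cons big_nil; lra.
- by apply: (go _ [:: 47; 53]%N _ pE) => //; rewrite !big_cons big_nil; lra.
- by apply: (go _ [:: 53; 59]%N _ pE) => //; rewrite !big_cons big_nil; lra.
- by apply: (go _ [:: 59; 61]%N _ pE) => //; rewrite !big_cons big_nil; lra.
- by apply: (go _ [:: 61; 67]%N _ pE) => //; rewrite !big_cons big_nil; lra.
- by apply: (go _ [:: 67; 71]%N _ pE) => //; rewrite !big_cons big_nil; lra.
Qed.

(** This is the overlap condition for the exponents of [p]. It follows from [tailprod_sum_le] with
    [N] beyond all the chosen primes, since [tail N >= 1]. *)
Lemma tailprod_ge p : prime p -> (5 <= p)%N -> 1 + p%:R ^- 2 <= tail p.+1.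
Proof.
move=> pp p5; have [s [us ps ss] le] := prime_tail_sum pp p5.
pose N := (p.+1 + \sum_(q <- s) q.+1)%N.
have sN q : q \in s -> (q < N)%N.
  by move=> qs; rewrite /N (big_rem q) //=; lia.
have le_sum : \sum_(q <- s) q%:R ^- 2 <= \sum_(p.+1 <= q < N | prime q) q%:R ^- 2 :> R.
  rewrite -[leRHS]big_filter; apply: ler_sum_sub => //.
    by rewrite filter_uniq // iota_uniq.
  move=> q qs; rewrite mem_filter (allP ps) // mem_index_iota.
  by have := allP ss q qs; have := sN q qs; rewrite /=; lia.
apply: le_trans (_ : 1 + \sum_(p.+1 <= q < N | prime q) q%:R ^- 2 <= _).
  by rewrite lerD2l (le_trans le).
have pN : (3 <= p.+1 <= N)%N by rewrite leq_addr; lia.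
apply: le_trans (tailprod_sum_le pN); rewrite ler_peMl //.
  by rewrite addr_ge0 // sumr_ge0 // => i _; exact: invsq_ge0.
by apply: tailprod_ge1; lia.
Qed.

(** * Numerical bounds on [pi^2] *)

Lemma tailprod3 : tail 3 = pi ^+ 2 / 8.
Proof. by rewrite /tailprod euler3 mulr1. Qed.

Lemma tailprod5 : tail 5 = pi ^+ 2 / 9.
Proof. by rewrite tailprodS //= tailprodS //= tailprod3; lra. Qed.

(** The case [p = 5] of [tailprod_ge] reads [26/25 <= 24/25 * pi^2 / 9]. *)
Lemma pi2_ge : 39 / 4 <= pi ^+ 2 :> R.
Proof.
have := tailprod_ge (p := 5) isT isT; rewrite tailprodS //= tailprod5; lra.
Qed.

(** From the third term on, [(2x + 1)^-2] is at most the telescoping [1/(4x) - 1/(4(x + 1))]. The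
    constant is [89/72 = 1 + 1/9 + 1/8], and adding the error [1/128] still leaves less than
    [10/8]. *)
Lemma pi2_lt : pi ^+ 2 < 10 :> R.
Proof.
have O m : odd_invsq_sum R m.+2 <= 89 / 72 - (4 * m.+2%:R)^-1.
  elim: m => [|m IH].
    by rewrite /odd_invsq_sum big_ltn // big_nat1 -[0.*2.+1]/1%N -[1.*2.+1]/3%N; lra.
  rewrite /odd_invsq_sum big_nat_recr //= -/(odd_invsq_sum _ _).
  apply: le_trans (lerD IH (lexx _)) _.
  have -> : m.+2.*2.+1%:R = 2 * m.+2%:R + 1 :> R by rewrite -[in LHS]addn1 natrD -mul2n natrM.
  rewrite [m.+3%:R]mulrS.
  have : 0 < m.+2%:R :> R by rewrite ltr0n.
  move: (m.+2%:R : R) => x x0.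
  have : (2 * x + 1) ^- 2 <= (4 * x * (1 + x))^-1.
    by rewrite lef_pV2 ?posrE ?exprn_gt0 ?mulr_gt0 //; nra.
  have -> : (4 * x * (1 + x))^-1 = (4 * x)^-1 - (4 * (1 + x))^-1.
    by field; rewrite !gt_eqF //; lra.
  lra.
have /andP[_ h] := odd_invsq_sum_pow2 R 7.
have := O 126; rewrite -[126.+2]/(2 ^ 7)%N.
have : 0 < (4 * (2 ^ 7)%:R)^-1 :> R by rewrite invr_gt0 mulr_gt0 // ltr0n.
have : 2 ^- 7 = 128^-1 :> R by lra.
lra.
Qed.

(** At a prime [M], [geom_cover] applies with [lo = 1] and [hi = tail M.+1], because
    [hi / (1 - M^-2) = tail M]; the quotient of [x] by the chosen [geom] is then treated from [M.+1]
    on. *)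
Lemma greedy M N x : (5 <= M <= N)%N -> 1 <= x < tail M ->
  exists2 n, rough M n & sigma n <= x < sigma n * tail N.
Proof.
move=> /andP[M5 /subnKC <-]; move: (N - M)%N => k; elim: k M x M5 => [|k IH] M x M5 xM.
  by exists 1%N; [exact: rough1|rewrite sigma1 mul1r addn0].
have M3 : (3 <= M)%N by apply: leq_trans M5.
have := tailprodS R M3; case: ifP => pM tE; last first.
  have [|n rn nx] := IH M.+1 x (leqW M5); first by rewrite tE.
  by exists n; [apply: rough_leq rn|rewrite -addSnnS].
have r01 := invsq_itv R (prime_gt1 pM); have /andP[r0 r1] := r01.
have t1 : 1 <= tail M.+1 by apply: tailprod_ge1; rewrite leqW.
have [|a _|a /andP[lo hi]] := @geom_cover R (M%:R ^- 2) 1 (tail M.+1) 0 x r01 (le_trans ler01 t1).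
- rewrite geom0 // mul1r tE mulfK; last by rewrite subr_eq0 gt_eqF.
  by case/andP: xM => -> ->.
- rewrite mulr1; apply: le_trans (geom_step r01 (leq0n a)) _.
  rewrite ler_wpM2l //; first by apply: le_trans ler01 _; exact: geom_ge1.
  by rewrite expr1; apply: tailprod_ge.
rewrite mulr1 in lo.
have g0 : 0 < geom (M%:R ^- 2 : R) a by apply: lt_le_trans ltr01 _; exact: geom_ge1.
have [|n rn /andP[nlo nhi]] := IH M.+1 (x / geom (M%:R ^- 2) a) (leqW M5).
  by rewrite ler_pdivlMr // mul1r lo ltr_pdivrMr // mulrC.
have [rMn Mn] := rough_prime_pow a pM rn.
exists (M ^ a * n)%N => //; rewrite sigma_prime_pow //; last by case: rn.
rewrite ler_pdivlMr // mulrC in nlo; rewrite nlo /=.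
by rewrite -addSnnS -mulrA mulrC -ltr_pdivrMr.
Qed.

(** The approximation is from below and with relative error, so that it is preserved under
    multiplication by a prime power factor ([approx_geom]). *)
Definition approx M x := forall e, 0 < e ->
  exists2 n, rough M n & sigma n <= x < sigma n * (1 + e).

Lemma approx_leq M N x : (M <= N)%N -> approx N x -> approx M x.
Proof. by move=> MN h e /h[n rn nx]; exists n => //; apply: rough_leq rn. Qed.

Lemma approx_tailprod M x : (5 <= M)%N -> 1 <= x < tail M -> approx M x.
Proof.
move=> M5 xM e e0; have [N N3 tN] := tailprod_near1 e0.
have [|n rn /andP[h1 h2]] := @greedy M (maxn M N) x _ xM; first by rewrite M5 leq_maxl.
exists n => //; rewrite h1 (lt_le_trans h2) // ler_wpM2l ?tN ?leq_maxr //.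
by apply: le_trans ler01 _; apply: sigma_ge1; case: rn.
Qed.

Lemma approx_geom p a x y : prime p -> x = geom (p%:R ^- 2) a * y ->
  approx p.+1 y -> approx p x.
Proof.
move=> pp -> ay e /ay[n rn /andP[h1 h2]].
have [rp pn] := rough_prime_pow a pp rn.
have g0 : 0 < geom (p%:R ^- 2 : R) a.
  by apply: lt_le_trans ltr01 _; apply: geom_ge1; exact: invsq_itv (prime_gt1 pp).
exists (p ^ a * n)%N => //; rewrite sigma_prime_pow //; last by case: rn.
by rewrite -[X in _ < X]mulrA ler_pM2l // ltr_pM2l // h1.
Qed.

Lemma approx_closure M x : approx M x -> closure (sigma @` [set n | (0 < n)%N]) x.
Proof.
move=> ax B /nbhs_ballP[e e0 eB].
have x0 : 0 <= x.
  have [n [n0 _] /andP[h _]] := ax 1 ltr01.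
  by apply: le_trans h; apply: le_trans ler01 _; exact: sigma_ge1.
have [|n rn /andP[h1 h2]] := ax (e / (x + 1)); first by rewrite divr_gt0 // ltr_wpDl.
exists (sigma n); split; first by exists n => //; case: rn.
apply: eB; rewrite /ball /= ger0_norm ?subr_ge0 // ltrBlDl.
apply: lt_le_trans h2 _; rewrite mulrDr mulr1 lerD2l mulrA ler_pdivrMr ?ltr_wpDl //.
rewrite mulrC ler_wpM2l //; first exact: ltW.
by apply: le_trans h1 _; rewrite lerDl.
Qed.

(** The approximation results need [z < y] strictly; the right endpoint is recovered because a
    closure is closed. *)
Lemma closure_itv (A : set R) x y : (forall z, x <= z < y -> closure A z) ->
  x < y -> `[x, y]%classic `<=` closure A.
Proof.
move=> h xy z /=; rewrite in_itv /= => /andP[xz]; rewrite le_eqVlt => /orP[/eqP ->|zy]; last first.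
  by apply: h; rewrite xz.
apply: (@closed_closure _ A).
move=> B /nbhs_ballP[e e0 eB].
pose w := Num.max x (y - e / 2).
exists w; split.
  by apply: h; rewrite le_max lexx /= gt_max xy ltrBlDr ltrDl divr_gt0.
apply: eB; rewrite /ball /= ger0_norm ?subr_ge0 ?ge_max ?(ltW xy) /=; last first.
  by rewrite gerBl divr_ge0 // ltW.
rewrite ltrBlDr -ltrBlDl lt_max; apply/orP; right.
by rewrite ltrD2l ltrN2 ltr_pdivrMr // mulr_natr mulr2n ltrDl.
Qed.

Lemma approx5 x : 1 <= x < pi ^+ 2 / 9 -> approx 5 x.
Proof. by move=> h; apply: approx_tailprod => //; rewrite tailprod5. Qed.

Lemma approx_odd3 x : 10 / 9 <= x < pi ^+ 2 / 8 -> approx 3 x.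
Proof.
move=> /andP[h1 h2]; have r01 : 0 < (3 ^- 2 : R) < 1 by apply: invsq_itv.
have [/andP[r0 r1] p2] := (r01, pi2_ge).
(* Exponents of 3 start at 1, where [geom] is [10/9]; from there on the overlap needs only
   [82/81 <= pi^2 / 9], and the limit of the right ends is [9/8 * pi^2 / 9]. *)
have [||a a1|a h] := @geom_cover R (3 ^- 2) 1 (pi ^+ 2 / 9) 1 x r01.
- lra.
- by rewrite geomS // geom0 //; apply/andP; split; [lra|rewrite ltr_pdivlMr; lra].
- rewrite mulr1; apply: le_trans (geom_step r01 a1) _.
  rewrite ler_wpM2l //; first by apply: le_trans ler01 _; exact: geom_ge1.
  lra.
rewrite mulr1 in h; have /andP[h3 h4] := h.
have g0 : 0 < geom (3 ^- 2 : R) a by apply: lt_le_trans ltr01 _; exact: geom_ge1.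
apply: (@approx_geom 3 a _ (x / geom (3 ^- 2) a)) => //.
  by rewrite mulrC divfK // gt_eqF.
apply: (@approx_leq _ 5) => //; apply: approx5.
by rewrite ler_pdivlMr // mul1r h3 ltr_pdivrMr // mulrC.
Qed.

(* For [a >= 1], the consecutive intervals [geom (1/4) a * [1, pi^2/9]] overlap and
   cover everything up to [4/3 * pi^2/9]; the intervals [geom (1/4) a * [10/9, pi^2/8]]
   overlap as well and cover everything from [5/4 * 10/9] on. *)
Lemma approx_even x : 5 / 4 <= x < pi ^+ 2 / 6 -> approx 2 x.
Proof.
move=> /andP[h1 h2]; have r01 : 0 < (2 ^- 2 : R) < 1 by apply: invsq_itv.
have [/andP[r0 r1] p2] := (r01, pi2_ge).
have g1 a : 1 <= geom (2 ^- 2 : R) a by exact: geom_ge1.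
have g0 a : 0 < geom (2 ^- 2 : R) a by apply: lt_le_trans ltr01 _.
have fin lo hi a : (forall y, lo <= y < hi -> approx 3 y) ->
    geom (2 ^- 2) a * lo <= x < geom (2 ^- 2) a * hi -> approx 2 x.
  move=> ap /andP[h3 h4].
  apply: (@approx_geom 2 a _ (x / geom (2 ^- 2) a)) => //.
    by rewrite mulrC divfK // gt_eqF.
  by apply: ap; rewrite ler_pdivlMr // mulrC h3 ltr_pdivrMr // mulrC.
(* Here [17/16 = 1 + (1/4)^2] is the bound of [geom_step] for [a0 = 1]. *)
have step (lo hi : R) a : (1 <= a)%N -> 17 / 16 * lo <= hi -> 0 <= lo ->
    geom (2 ^- 2) a.+1 * lo <= geom (2 ^- 2) a * hi.
  move=> a1 lohi lo0; apply: le_trans (ler_wpM2r lo0 (geom_step r01 a1)) _.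
  by rewrite -mulrA ler_pM2l //; lra.
have [xs|xl] := ltP x (4 / 3 * (pi ^+ 2 / 9)).
  have [||a a1|a h] := @geom_cover R (2 ^- 2) 1 (pi ^+ 2 / 9) 1 x r01.
  - lra.
  - by rewrite geomS // geom0 //; apply/andP; split; [lra|rewrite ltr_pdivlMr; lra].
  - by apply: step => //; lra.
  apply: fin h => y hy; apply: (@approx_leq _ 5) => //; exact: approx5.
have [||a a1|a h] := @geom_cover R (2 ^- 2) (10 / 9) (pi ^+ 2 / 8) 1 x r01.
- lra.
- by rewrite geomS // geom0 //; apply/andP; split; [lra|rewrite ltr_pdivlMr; lra].
- by apply: step => //; lra.
by apply: fin h => y hy; exact: approx_odd3.
Qed.

(** * Values on the classes determined by divisibility by 2 and 3 *)

Lemma sigma_coprime6 n : odd n -> ~~ (3 %| n)%N -> 1 <= sigma n <= pi ^+ 2 / 9.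
Proof.
move=> on n3; have n0 : (0 < n)%N by case: n on n3.
rewrite sigma_ge1 //= -tailprod5; apply: sigma_le_tailprod => //; split=> // p pp pn.
have op : odd p := dvdn_odd pn on.
have : p != 3%N by apply/eqP => p3; rewrite -p3 pn in n3.
have := odd_prime_gt2 op pp; case: p op {pp pn} => [|[|[|[|[|p]]]]] //.
Qed.

Lemma sigma_odd3 n : odd n -> (3 %| n)%N -> 10 / 9 <= sigma n <= pi ^+ 2 / 8.
Proof.
move=> on n3; have n0 : (0 < n)%N by case: n on n3.
rewrite sigma_odd_le // andbT.
have := @ler_sum_sub R _ [:: 1%N; 3%N] _ _ isT (divisors_uniq n) _ (@invsq_ge0 R).
rewrite big_cons big_seq1 => h; apply: le_trans (h _); first by lra.
by move=> d; rewrite !inE => /orP[] /eqP ->; rewrite -dvdn_divisors.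
Qed.

(** The divisors 1 and 2 give the lower bound; the upper one is the product of [4/3] for the power
    of 2 and [pi^2 / 8] for the odd part. *)
Lemma sigma_even n : (0 < n)%N -> ~~ odd n -> 5 / 4 <= sigma n <= pi ^+ 2 / 6.
Proof.
move=> n0 en; apply/andP; split.
  have := @ler_sum_sub R _ [:: 1%N; 2%N] _ _ isT (divisors_uniq n) _ (@invsq_ge0 R).
  rewrite big_cons big_seq1 => h; apply: le_trans (h _); first by lra.
  by move=> d; rewrite !inE => /orP[] /eqP ->; rewrite -dvdn_divisors // dvdn2.
have [a [m [-> m0 m2]]] := prime_pow_split (isT : prime 2) n0.
rewrite sigma_prime_pow //.
have g1 : geom (2 ^- 2 : R) a <= 4 / 3.
  have := @geom_mul_le1 R (2 ^- 2) a (invsq_itv R (isT : (1 < 2)%N)); lra.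
have s2 : sigma m <= pi ^+ 2 / 8 by apply: sigma_odd_le; rewrite dvdn2 negbK in m2.
have s1 := sigma_ge1 R m0.
have : geom (2 ^- 2) a * sigma m <= 4 / 3 * (pi ^+ 2 / 8).
  apply: ler_pM => //; last by apply: le_trans s1.
  by apply: le_trans ler01 _; apply: geom_ge1; exact: invsq_itv.
by lra.
Qed.

End Range.

(** * Density *)

Section Density.
Implicit Types (P : pred nat) (k m n : nat).

Lemma count_iota_period P k m : (forall n, P (n + k)%N = P n) ->
  count P (iota m k) = count P (iota 0 k).
Proof.
move=> Pk; elim: m => // m <-.
have e1 : iota m k.+1 = m :: iota m.+1 k by [].
have e2 : iota m k.+1 = iota m k ++ [:: (m + k)%N] by rewrite -addn1 iotaD.
have := congr1 (count P) (etrans (esym e1) e2).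
by rewrite count_cat /= addn0 Pk; lia.
Qed.

(** The full periods in [1..N] contribute exactly; the remaining fewer than [k] integers account for
    the error [k * k]. *)
Lemma count_iota_bounds P k N : (0 < k)%N -> (forall n, P (n + k)%N = P n) ->
  (count P (iota 0 k) * N <= k * count P (iota 1 N) + k * k /\
   k * count P (iota 1 N) <= count P (iota 0 k) * N + k * k)%N.
Proof.
move=> k0 Pk; set c := count P (iota 0 k).
have ck : (c <= k)%N by rewrite -[X in (_ <= X)%N](size_iota 0 k) count_size.
have cq q m : count P (iota m (q * k)) = (q * c)%N.
  elim: q m => [|q IH] m; first by rewrite !mul0n.
  by rewrite mulSn iotaD count_cat IH (count_iota_period m Pk) mulSn.
have rk := ltnW (ltn_pmod N k0).
have := divn_eq N k; move: (N %/ k)%N (N %% k)%N rk => q r rk ->.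
rewrite iotaD count_cat cq.
have := count_size P (iota (1 + q * k) r); rewrite size_iota.
move: (count P (iota _ r)) => d dr.
have := leq_mul ck rk; have := leq_mul (leqnn k) (leq_trans dr rk).
by split; nia.
Qed.

Lemma count_upto_pos (R : realType) P (x : R) : 0 <= x ->
  count_upto [set n | (0 < n)%N /\ P n] x = count P (iota 1 (Num.truncn x)).
Proof.
move=> x0; rewrite /count_upto; set A := [set n | _].
have AE : A = [set` [seq n <- iota 1 (Num.truncn x) | P n]].
  apply/seteqP; split=> n; rewrite /A /= mem_filter mem_iota add1n ltnS truncn_ge_nat //.
    by move=> [[-> ->] ->].
  by move=> /andP[-> /andP[-> ->]].
have fA : finite_set A by rewrite AE; exact: finite_seq.
have -> : fset_set A = [fset n in [seq n <- iota 1 (Num.truncn x) | P n]]%fset.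
  apply/fsetP => n; rewrite in_fset_set // inE AE.
  by apply/idP/idP; rewrite inE.
by rewrite card_fseq undup_id ?size_filter // filter_uniq // iota_uniq.
Qed.

Lemma periodic_has_density (R : realType) P k : (0 < k)%N ->
  (forall n, P (n + k)%N = P n) ->
  has_density [set n | (0 < n)%N /\ P n] ((count P (iota 0 k))%:R / k%:R : R).
Proof.
move=> k0 Pk; apply/cvgrPdist_lt => e e0.
near=> x.
have x0 : 0 < x by near: x; exact: nbhs_pinfty_gt.
(* Replacing [x] by its integer part costs at most the count per period, so the total error is at
   most [k * k + k], which this choice makes smaller than [e * k * x]. *)
have xe : (k%:R + 1) / e < x by near: x; apply: nbhs_pinfty_gt; rewrite num_real.
rewrite count_upto_pos; last exact: ltW.
have /andP[Nx xN] := truncn_itv (ltW x0).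
have [] := count_iota_bounds (Num.truncn x) k0 Pk.
rewrite -!(ler_nat R) !natrD !natrM.
have ck : (count P (iota 0 k))%:R <= k%:R :> R.
  by rewrite ler_nat -[X in (_ <= X)%N](size_iota 0 k) count_size.
have c0 : 0 <= (count P (iota 0 k))%:R :> R by [].
have kR : 0 < k%:R :> R by rewrite ltr0n.
rewrite -natr1 in xN.
move: (k%:R : R) kR xe ((count P (iota 0 k))%:R) c0 ck ((count P (iota 1 _))%:R) (_%:R) Nx xN.
move=> K kR xe c c0 ck d N Nx xN h1 h2.
have -> : c / K - d / x = (c * x - K * d) / (K * x) by field; rewrite !gt_eqF.
rewrite normrM [X in _ * X]gtr0_norm ?invr_gt0 ?mulr_gt0 // ltr_pdivrMr ?mulr_gt0 //.
have : K * (K + 1) < e * (K * x).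
  by rewrite mulrCA ltr_pM2l // -ltr_pdivrMl // mulrC.
apply: le_lt_trans; have := ler_wpM2l c0 Nx; have := ler_wpM2l c0 (ltW xN).
by rewrite ler_norml => u v; apply/andP; split; lra.
Unshelve. all: by end_near. Qed.
End Density.

Theorem mainTheorem2 (R : realType) :
  let sigma : nat -> R := sigma_m2 in
  let I1 : set R := `[1, pi ^+ 2 / 9]%classic in
  let I2 : set R := `[10 / 9, pi ^+ 2 / 8]%classic in
  let I3 : set R := `[5 / 4, pi ^+ 2 / 6]%classic in
  [/\ closure (sigma @` [set n | (0 < n)%N]) = I1 `|` I2 `|` I3,
      [/\ I1 `&` I2 = set0, I1 `&` I3 = set0 & I2 `&` I3 = set0]
    & [/\ has_density [set n | (0 < n)%N /\ I1 (sigma n)] (1 / 3 : R),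
          has_density [set n | (0 < n)%N /\ I2 (sigma n)] (1 / 6 : R)
        & has_density [set n | (0 < n)%N /\ I3 (sigma n)] (1 / 2 : R)]].
Proof.
move=> sigma I1 I2 I3.
have plo := pi2_ge R; have phi := pi2_lt R.
have I1E x : I1 x = (1 <= x <= pi ^+ 2 / 9) :> Prop by rewrite /I1 /= in_itv.
have I2E x : I2 x = (10 / 9 <= x <= pi ^+ 2 / 8) :> Prop by rewrite /I2 /= in_itv.
have I3E x : I3 x = (5 / 4 <= x <= pi ^+ 2 / 6) :> Prop by rewrite /I3 /= in_itv.
(* Together with disjointness this turns membership of [sigma n] in an interval into a congruence
   condition on [n]. *)
have trichotomy n : (0 < n)%N -> [\/ [/\ odd n, ~~ (3 %| n)%N & I1 (sigma n)],
    [/\ odd n, (3 %| n)%N & I2 (sigma n)] | ~~ odd n /\ I3 (sigma n)].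
  move=> n0; rewrite I1E I2E I3E; case: (boolP (odd n)) => on; last first.
    by apply: Or33; split=> //; exact: sigma_even.
  have [n3|n3] := boolP (3 %| n)%N.
    by apply: Or32; split=> //; exact: sigma_odd3.
  by apply: Or31; split=> //; exact: sigma_coprime6.
(* Both [pi^2 / 9 < 10/9] and [pi^2 / 8 < 5/4] amount to [pi^2 < 10]. *)
have d12 x : I1 x -> I2 x -> False by rewrite I1E I2E => /andP[_ ?] /andP[? _]; lra.
have d13 x : I1 x -> I3 x -> False by rewrite I1E I3E => /andP[_ ?] /andP[? _]; lra.
have d23 x : I2 x -> I3 x -> False by rewrite I2E I3E => /andP[_ ?] /andP[? _]; lra.
split.
- apply/seteqP; split.
    have cI : closed (I1 `|` I2 `|` I3).
      by apply: closedU; [apply: closedU|]; exact: itv_closed.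
    rewrite (_ : I1 `|` I2 `|` I3 = closure (I1 `|` I2 `|` I3)); last exact/closure_id.
    apply: closure_subset => _ [n n0 <-].
    by case: (trichotomy n n0) => [[_ _ h]|[_ _ h]|[_ h]]; [left; left|left; right|right].
  move=> x [[|]|]; apply: closure_itv x; try lra.
  + by move=> z hz; apply: (@approx_closure _ 5); exact: approx5.
  + by move=> z hz; apply: (@approx_closure _ 3); exact: approx_odd3.
  + by move=> z hz; apply: (@approx_closure _ 2); exact: approx_even.
- by split; apply/seteqP; split=> // x [] /=; [exact: d12|exact: d13|exact: d23].
split.
- have -> : [set n | (0 < n)%N /\ I1 (sigma n)] =
      [set n | (0 < n)%N /\ odd n && ~~ (3 %| n)%N].
    apply/seteqP; split=> n /= [n0 h]; split=> //.
      by case: (trichotomy n n0) => [[-> ->]|[_ _ /(d12 _ h)]|[_ /(d13 _ h)]].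
    by case: (trichotomy n n0) h => [[]|[-> ->]|[/negbTE ->]].
  have -> : 1 / 3 = (count (fun n => odd n && ~~ (3 %| n)%N) (iota 0 6))%:R / 6%:R :> R.
    by rewrite (_ : count _ _ = 2%N); [lra|vm_compute].
  apply: periodic_has_density => // n.
  by rewrite oddD addbF dvdn_addl.
- have -> : [set n | (0 < n)%N /\ I2 (sigma n)] =
      [set n | (0 < n)%N /\ odd n && (3 %| n)%N].
    apply/seteqP; split=> n /= [n0 h]; split=> //.
      by case: (trichotomy n n0) => [[_ _ /d12/(_ h)]|[-> ->]|[_ /(d23 _ h)]].
    by case: (trichotomy n n0) h => [[-> /negbTE ->]|[_ _ ]|[/negbTE ->]].
  have -> : 1 / 6 = (count (fun n => odd n && (3 %| n)%N) (iota 0 6))%:R / 6%:R :> R.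
    by rewrite (_ : count _ _ = 1%N); [lra|vm_compute].
  apply: periodic_has_density => // n.
  by rewrite oddD addbF dvdn_addl.
have -> : [set n | (0 < n)%N /\ I3 (sigma n)] = [set n | (0 < n)%N /\ ~~ odd n].
  apply/seteqP; split=> n /= [n0 h]; split=> //.
    by case: (trichotomy n n0) => [[_ _ /d13/(_ h)]|[_ _ /d23/(_ h)]|[]].
  by case: (trichotomy n n0) h => [[->]|[->]|[]].
have -> : 1 / 2 = (count (fun n => ~~ odd n) (iota 0 2))%:R / 2%:R :> R.
  by rewrite (_ : count _ _ = 1%N); [lra|vm_compute].
by apply: periodic_has_density => // n; rewrite oddD addbF.
Qed.
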